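(* Let $n\ge 1$ be an integer and let $f:\Delta_n(O,X,Y,Z)\to\mathbb{R}$ be a polarized function, where $\Delta_n(O,X,Y,Z)=\{(x,y,z)\in\mathbb{Z}^3: x,y,z\ge 0,\ x+y+z\le n\}$. Suppose that the restriction of $f$ to the ground face (the function $(x,y)\mapsto f(x,y,0)$ on $\{x,y\ge 0,\ x+y\le n\}$) and the restriction of $f$ to the ceiling face (the function $(x,y)\mapsto f(x,y,n-x-y)$ on $\{x,y\ge 0,\ x+y\le n\}$) are both two-dimensional discretely concave. Then $f\in PCPM_n$, i.e. $f$ is a polarized discretely concave function on $\Delta_n(O,X,Y,Z)$.
   Context: Let $e_1,e_2,e_3$ be the standard basis of $\mathbb{Z}^3$. A unitary octahedron is a set of six lattice points $\{v+e_1,\ v+e_2,\ v+e_3,\ v+e_1+e_2,\ v+e_1+e_3,\ v+e_2+e_3\}$ for some $v\in\mathbb{Z}^3$; its three pairs of antipodal vertices are $\{v+e_1,v+e_2+e_3\}$, $\{v+e_2,v+e_1+e_3\}$ and $\{v+e_3,v+e_1+e_2\}$, the last pair being called the main diagonal. A function $f$ on $\Delta_n(O,X,Y,Z)$ is polarized if for every unitary octahedron all of whose vertices lie in $\Delta_n(O,X,Y,Z)$, $f(v+e_3)+f(v+e_1+e_2)=\max\big(f(v+e_1)+f(v+e_2+e_3),\ f(v+e_2)+f(v+e_1+e_3)\big)$. A function $g$ defined on a set $S\subseteq\mathbb{Z}^2$ is two-dimensional discretely concave if the following three rhombus inequalities hold for all integers $i,j$ for which all four points involved lie in $S$: (i)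 $g(i,j)+g(i+1,j+1)\le g(i+1,j)+g(i,j+1)$; (ii) $g(i+1,j)+g(i+1,j+1)\ge g(i,j+1)+g(i+2,j)$; (iii) $g(i,j+1)+g(i+1,j+1)\ge g(i,j+2)+g(i+1,j)$. (Equivalently, the piecewise-linear interpolation of $g$ over the triangulation cut out by the lines $x=\mathrm{const}$, $y=\mathrm{const}$, $x+y=\mathrm{const}$ (integer constants) is concave, when $S$ is a lattice triangle of this form.) $PCPM_n$ is the set of functions $f$ on $\Delta_n(O,X,Y,Z)$ that are polarized and satisfy all rhombus inequalities in all cutting planes, i.e. for every integer $c$ each of the following functions is two-dimensional discretely concave on the set of points where it is defined (points of $\Delta_n(O,X,Y,Z)$ in the corresponding plane): $(x,y)\mapsto f(x,y,c)$ (plane $z=c$), $(y,z)\mapsto f(c,y,z)$ (plane $x=c$), $(x,z)\mapsto f(x,c,z)$ (plane $y=c$), and $(x,y)\mapsto f(x,y,c-x-y)$ (plane $x+y+z=c$). *)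

(* Defs.v *)
From mathcomp Require Import all_boot all_order all_algebra.
From mathcomp Require Import reals.
Set Implicit Arguments.
Unset Strict Implicit.
Unset Printing Implicit Defensive.
Import Order.TTheory GRing.Theory Num.Theory.
Local Open Scope ring_scope.

(* Functions on a set of lattice points are total functions on Z^2 or Z^3; the
   domain is a separate boolean predicate, and every condition below only
   constrains values at points of that domain. *)

Definition tetrahedron (n : nat) (x y z : int) : bool :=
  [&& 0 <= x, 0 <= y, 0 <= z & x + y + z <= n%:Z].

Definition triangle (n : nat) (x y : int) : bool :=
  [&& 0 <= x, 0 <= y & x + y <= n%:Z].

(* The six vertices of the unitary octahedron attached to v = (x, y, z), in the
   order v+e1, v+e2, v+e3, v+e1+e2, v+e1+e3, v+e2+e3. *)
Definition octahedron_in (D : int -> int -> int -> bool) (x y z : int) : bool :=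
  [&& D (x + 1) y z, D x (y + 1) z, D x y (z + 1),
      D (x + 1) (y + 1) z, D (x + 1) y (z + 1) & D x (y + 1) (z + 1)].

Definition polarized (R : realType) (n : nat) (f : int -> int -> int -> R) : Prop :=
  forall x y z : int, octahedron_in (tetrahedron n) x y z ->
    f x y (z + 1) + f (x + 1) (y + 1) z =
    Num.max (f (x + 1) y z + f x (y + 1) (z + 1))
            (f x (y + 1) z + f (x + 1) y (z + 1)).

Definition discretely_concave2 (R : realType)
    (S : int -> int -> bool) (g : int -> int -> R) : Prop :=
  [/\ forall i j : int,
        [&& S i j, S (i + 1) (j + 1), S (i + 1) j & S i (j + 1)] ->
        g i j + g (i + 1) (j + 1) <= g (i + 1) j + g i (j + 1),
      forall i j : int,
        [&& S (i + 1) j, S (i + 1) (j + 1), S i (j + 1) & S (i + 2) j] ->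
        g (i + 1) j + g (i + 1) (j + 1) >= g i (j + 1) + g (i + 2) j
    & forall i j : int,
        [&& S i (j + 1), S (i + 1) (j + 1), S i (j + 2) & S (i + 1) j] ->
        g i (j + 1) + g (i + 1) (j + 1) >= g i (j + 2) + g (i + 1) j].

Definition PCPM (R : realType) (n : nat) (f : int -> int -> int -> R) : Prop :=
  polarized n f /\
  forall c : int,
    [/\ discretely_concave2 (fun x y => tetrahedron n x y c)
                            (fun x y => f x y c),
        discretely_concave2 (fun y z => tetrahedron n c y z)
                            (fun y z => f c y z),
        discretely_concave2 (fun x z => tetrahedron n x c z)
                            (fun x z => f x c z)
      & discretely_concave2 (fun x y => tetrahedron n x y (c - x - y))
                            (fun x y => f x y (c - x - y))].

(* Main.v *)
Require Import Defs.
From mathcomp Require Import all_boot all_order all_algebra.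
From mathcomp Require Import reals.
From mathcomp Require Import zify lra.
Set Implicit Arguments.
Unset Strict Implicit.
Unset Printing Implicit Defensive.
Import Order.TTheory GRing.Theory Num.Theory.
Local Open Scope ring_scope.

(** In barycentric coordinates (n - x - y - z, x, y, z), numbered 0 to 3, put
    f_ij = f (w + e_i + e_j) for a point w >= 0 of weight n - 2. The twelve
    rhombus inequalities at w are
      R_w(i; j k) :  f_ii + f_jk <= f_ij + f_ik,
    and polarization reads f_03 + f_12 = max (f_01 + f_23) (f_02 + f_13).
    Everything is symmetric under 0 <-> 3 and under 1 <-> 2.
    - By polarization at w, R_w(0; 12) is equivalent to R_w(0; 13) together with
      R_w(0; 23), and R_w(1; 03) to R_w(1; 02) together with R_w(1; 23).
    - By polarization at u + e_1 and u + e_2, the inequalities R(1; 02) and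
      R(1; 23) at u + e_2 give R(1; 23) at u + e_0 and, symmetrically, R(1; 02)
      at u + e_3. This settles the apex 1 by induction on w_0 + w_3, the cases
      w_3 = 0 and w_0 = 0 being given by the ground and the ceiling; the apex 2
      is symmetric.
    - By polarization at u + e_0, R(0; 23) at u + e_1 and R(0; 13) at u + e_2
      give R(0; 12) at u + e_3, which settles the apex 0 by induction on w_3, and
      symmetrically the apex 3. *)

Section Barycentric.
Variable R : realDomainType.
Implicit Types F : nat -> nat -> nat -> nat -> R.

Definition swap03 F a b c d := F d b c a.
Definition swap12 F a b c d := F a c b d.

Definition octahedral (n : nat) F := forall a b c d : nat,
  (a + b + c + d).+2 = n ->
  F a.+1 b c d.+1 + F a b.+1 c.+1 d =
  Num.max (F a.+1 b.+1 c d + F a b c.+1 d.+1)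
          (F a.+1 b c.+1 d + F a b.+1 c d.+1).

(* [rhombus_i_jk F a b c d] is R_w(i; j k) at w = (a, b, c, d). The remaining
   inequalities are those of [swap03 F] and [swap12 F]. *)
Definition rhombus_0_12 F a b c d :=
  F a.+2 b c d + F a b.+1 c.+1 d <= F a.+1 b.+1 c d + F a.+1 b c.+1 d.
Definition rhombus_0_13 F a b c d :=
  F a.+2 b c d + F a b.+1 c d.+1 <= F a.+1 b.+1 c d + F a.+1 b c d.+1.
Definition rhombus_1_02 F a b c d :=
  F a b.+2 c d + F a.+1 b c.+1 d <= F a.+1 b.+1 c d + F a b.+1 c.+1 d.
Definition rhombus_1_03 F a b c d :=
  F a b.+2 c d + F a.+1 b c d.+1 <= F a.+1 b.+1 c d + F a b.+1 c d.+1.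

Lemma octahedral_swap03 n F : octahedral n F -> octahedral n (swap03 F).
Proof.
move=> oF a b c d e; rewrite /swap03 oF; last by lia.
by rewrite maxC [X in Num.max X _]addrC [X in Num.max _ X]addrC.
Qed.

Lemma octahedral_swap12 n F : octahedral n F -> octahedral n (swap12 F).
Proof. by move=> oF a b c d e; rewrite /swap12 oF 1?maxC//; lia. Qed.

(** Add f_02 + f_13 <= f_03 + f_12, one half of polarization. *)
Lemma rhombus_0_13_of_0_12 n F a b c d : octahedral n F ->
  (a + b + c + d).+2 = n -> rhombus_0_12 F a b c d -> rhombus_0_13 F a b c d.
Proof.
move=> oF e; have := oF a b c d e.
by case: leP => ? ?; rewrite /rhombus_0_12 /rhombus_0_13; lra.
Qed.

Lemma rhombus_1_03_of_1_02 n F a b c d : octahedral n F ->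
  (a + b + c + d).+2 = n ->
  rhombus_1_02 F a b c d -> rhombus_1_02 (swap03 F) d b c a ->
  rhombus_1_03 F a b c d.
Proof.
move=> oF e; have := oF a b c d e.
by case: leP => ? ?; rewrite /rhombus_1_02 /rhombus_1_03 /swap03; lra.
Qed.

(** Polarization at u + e_1 serves as a lower bound for its main diagonal; at u + e_2, each branch
    of the max is settled by one of the two hypotheses. *)
Lemma rhombus_1_02_step n F a b c d : octahedral n F ->
  (a + b + c + d).+3 = n ->
  rhombus_1_02 F a b c.+1 d ->
  rhombus_1_02 (swap03 F) d b c.+1 a ->
  rhombus_1_02 (swap03 F) d b c a.+1.
Proof.
move=> oF e.
have := oF a b.+1 c d ltac:(lia); have := oF a b c.+1 d ltac:(lia).
by case: leP => ? ?; case: leP => ? ?;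
   rewrite /rhombus_1_02 /swap03; lra.
Qed.

Lemma rhombus_0_12_step n F a b c d : octahedral n F ->
  (a + b + c + d).+3 = n ->
  rhombus_0_13 (swap12 F) a c b.+1 d -> rhombus_0_13 F a b c.+1 d ->
  rhombus_0_12 F a b c d.+1.
Proof.
move=> oF e; have := oF a.+1 b c d ltac:(lia).
by case: leP => ? ?; rewrite /rhombus_0_12 /rhombus_0_13 /swap12; lra.
Qed.

(** The two conclusions go together because each step consumes both, at a point where a unit has
    moved from coordinate 0 or 3 to coordinate 2. *)
Lemma rhombus_1_02_all n F : octahedral n F ->
  (forall a b c, (a + b + c).+2 = n -> rhombus_1_02 F a b c 0) ->
  (forall b c d, (b + c + d).+2 = n -> rhombus_1_02 (swap03 F) d b c 0) ->
  forall a b c d, (a + b + c + d).+2 = n ->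
  rhombus_1_02 F a b c d /\ rhombus_1_02 (swap03 F) d b c a.
Proof.
move=> oF ground ceiling a b c d; move: {-1}(a + d)%N (erefl (a + d)%N) => t.
elim: t a b c d => [|t IH] a b c d ht e.
  have [-> ->] : a = 0%N /\ d = 0%N by lia.
  by split; [apply: ground | apply: ceiling]; lia.
split.
- case: d => [|d] in ht e *; first by apply: ground; lia.
  have [? ?] := IH a b c.+1 d ltac:(lia) ltac:(lia).
  by apply: (rhombus_1_02_step (octahedral_swap03 oF) (a := d)); first lia.
- case: a => [|a] in ht e *; first by apply: ceiling; lia.
  have [? ?] := IH a b c.+1 d ltac:(lia) ltac:(lia).
  by apply: (rhombus_1_02_step oF); first lia.
Qed.

Lemma rhombus_0_12_all n F : octahedral n F ->
  (forall a b c, (a + b + c).+2 = n -> rhombus_0_12 F a b c 0) ->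
  forall a b c d, (a + b + c + d).+2 = n -> rhombus_0_12 F a b c d.
Proof.
move=> oF ground a b c d.
elim: d a b c => [|d IH] a b c e; first by apply: ground; lia.
apply: (rhombus_0_12_step oF); first by lia.
- apply: (rhombus_0_13_of_0_12 (octahedral_swap12 oF)); first by lia.
  have := IH a b.+1 c ltac:(lia).
  by rewrite /rhombus_0_12 /swap12 [leRHS]addrC.
- by apply: (rhombus_0_13_of_0_12 oF); [lia | apply: IH; lia].
Qed.

End Barycentric.

(* The coordinate 0 is determined by the others on the domain. *)
Definition barycentric (T : Type) (f : int -> int -> int -> T)
  (a b c d : nat) := f b c d.

Lemma barycentricP (n : nat) (x y z : int) :
  0 <= x -> 0 <= y -> 0 <= z -> x + y + z + 2 <= n%:Z ->
  exists a b c d : nat,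
    [/\ (a + b + c + d).+2 = n, x = b%:Z, y = c%:Z & z = d%:Z].
Proof.
move=> x0 y0 z0 xyz.
exists (absz (n%:Z - 2 - x - y - z)%R), (absz x), (absz y), (absz z).
by split; lia.
Qed.

Lemma leD_congr (V : porderZmodType) (p1 p2 p3 p4 q1 q2 q3 q4 : V) :
  p1 + p2 <= p3 + p4 -> p1 = q1 -> p2 = q2 -> p3 = q3 -> p4 = q4 ->
  q1 + q2 <= q3 + q4.
Proof. by move=> le_p <- <- <- <-. Qed.

(* [le_points le_p] proves an inequality between values that is [le_p] up to
   commutativity of addition on each side and linear equality of the points. *)
Ltac le_points le_p :=
  let close := solve [apply: (leD_congr le_p); f_equal; lia] in
  unfold rhombus_0_12, rhombus_0_13, rhombus_1_02, rhombus_1_03, swap03, swap12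
    in le_p |- *;
  try match goal with F := barycentric _ |- _ => unfold F in le_p |- * end;
  unfold barycentric in le_p |- *;
  first [ close | rewrite [leLHS]addrC; close | rewrite [leRHS]addrC; close
        | rewrite [leLHS]addrC [leRHS]addrC; close ].

Theorem mainTheorem1 (R : realType) (n : nat) (f : int -> int -> int -> R)
  (n_ge1 : (1 <= n)%N)
  (f_polarized : polarized n f)
  (ground_concave : discretely_concave2 (triangle n) (fun x y => f x y 0))
  (ceiling_concave :
     discretely_concave2 (triangle n) (fun x y => f x y (n%:Z - x - y))) :
  PCPM n f.
Proof.
pose F := barycentric f.
have oF : octahedral n F.
  move=> a b c d e.
  have := f_polarized b c d; rewrite /octahedron_in /tetrahedron.
  rewrite /F /barycentric => /(_ ltac:(lia)).
  by rewrite !intS ![1 + _]addrC.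
have [G1 G2 G3] := ground_concave; have [C1 C2 C3] := ceiling_concave.
have oF0 := octahedral_swap03 oF; have oF1 := octahedral_swap12 oF.
have oF01 := octahedral_swap03 oF1.
have r1 : forall a b c d, (a + b + c + d).+2 = n ->
    rhombus_1_02 F a b c d /\ rhombus_1_02 (swap03 F) d b c a.
  apply: (rhombus_1_02_all oF) => [a b c e | b c d e].
    have := G2 b%:Z c%:Z; rewrite /triangle => /(_ ltac:(lia)) le_p.
    by le_points le_p.
  have := C2 b%:Z c%:Z; rewrite /triangle => /(_ ltac:(lia)) le_p.
  by le_points le_p.
have r2 : forall a b c d, (a + b + c + d).+2 = n ->
    rhombus_1_02 (swap12 F) a b c d /\ rhombus_1_02 (swap03 (swap12 F)) d b c a.
  apply: (rhombus_1_02_all oF1) => [a b c e | b c d e].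
    have := G3 c%:Z b%:Z; rewrite /triangle => /(_ ltac:(lia)) le_p.
    by le_points le_p.
  have := C3 c%:Z b%:Z; rewrite /triangle => /(_ ltac:(lia)) le_p.
  by le_points le_p.
have r0 : forall a b c d, (a + b + c + d).+2 = n -> rhombus_0_12 F a b c d.
  apply: (rhombus_0_12_all oF) => a b c e.
  have := G1 b%:Z c%:Z; rewrite /triangle => /(_ ltac:(lia)) le_p.
  by le_points le_p.
have r3 : forall a b c d, (a + b + c + d).+2 = n ->
    rhombus_0_12 (swap03 F) a b c d.
  apply: (rhombus_0_12_all oF0) => a b c e.
  have := C1 b%:Z c%:Z; rewrite /triangle => /(_ ltac:(lia)) le_p.
  by le_points le_p.
(* R(0; 12) is invariant under 1 <-> 2. *)
have r0' : forall a b c d, (a + b + c + d).+2 = n ->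
    rhombus_0_12 (swap12 F) a b c d.
  move=> a b c d e; rewrite /rhombus_0_12 [leRHS]addrC; apply: (r0 a c b d); lia.
have r3' : forall a b c d, (a + b + c + d).+2 = n ->
    rhombus_0_12 (swap03 (swap12 F)) a b c d.
  move=> a b c d e; rewrite /rhombus_0_12 [leRHS]addrC; apply: (r3 a c b d); lia.
have q0 a b c d e := rhombus_0_13_of_0_12 oF e (r0 a b c d e).
have q0' a b c d e := rhombus_0_13_of_0_12 oF1 e (r0' a b c d e).
have q3 a b c d e := rhombus_0_13_of_0_12 oF0 e (r3 a b c d e).
have q3' a b c d e := rhombus_0_13_of_0_12 oF01 e (r3' a b c d e).
have q1 a b c d e :=
  rhombus_1_03_of_1_02 oF e (r1 a b c d e).1 (r1 a b c d e).2.
have q2 a b c d e :=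
  rhombus_1_03_of_1_02 oF1 e (r2 a b c d e).1 (r2 a b c d e).2.
(* Each plane fixes one barycentric coordinate (3, 1, 2, 0 in turn); its rhombi are the R(i; j k) on
   the other three indices. *)
split=> // k; split; split=> i j; rewrite /tetrahedron => D; cbv beta.
- have [||||a [b [c [d [e ? ? ?]]]]] := @barycentricP n i j k; try lia.
  by have le_p := r0 a b c d e; le_points le_p.
- have [||||a [b [c [d [e ? ? ?]]]]] := @barycentricP n i j k; try lia.
  by have le_p := (r1 a b c d e).1; le_points le_p.
- have [||||a [b [c [d [e ? ? ?]]]]] := @barycentricP n i j k; try lia.
  by have le_p := (r2 a c b d ltac:(lia)).1; le_points le_p.
- have [||||a [b [c [d [e ? ? ?]]]]] := @barycentricP n k i j; try lia.
  by have le_p := q0' a c b d ltac:(lia); le_points le_p.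
- have [||||a [b [c [d [e ? ? ?]]]]] := @barycentricP n k i j; try lia.
  by have le_p := q2 a c b d ltac:(lia); le_points le_p.
- have [||||a [b [c [d [e ? ? ?]]]]] := @barycentricP n k i j; try lia.
  by have le_p := q3' d c b a ltac:(lia); le_points le_p.
- have [||||a [b [c [d [e ? ? ?]]]]] := @barycentricP n i k j; try lia.
  by have le_p := q0 a b c d e; le_points le_p.
- have [||||a [b [c [d [e ? ? ?]]]]] := @barycentricP n i k j; try lia.
  by have le_p := q1 a b c d e; le_points le_p.
- have [||||a [b [c [d [e ? ? ?]]]]] := @barycentricP n i k j; try lia.
  by have le_p := q3 d b c a ltac:(lia); le_points le_p.
(* The corner (i, j) is w + 2 e_3, hence the shift by 2. *)
- have [||||a [b [c [d [e ? ? ?]]]]] := @barycentricP n i j (k - i - j - 2);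
    try lia.
  by have le_p := r3 d b c a ltac:(lia); le_points le_p.
- have [||||a [b [c [d [e ? ? ?]]]]] := @barycentricP n i j (k - i - j - 2);
    try lia.
  by have le_p := (r1 a b c d e).2; le_points le_p.
- have [||||a [b [c [d [e ? ? ?]]]]] := @barycentricP n i j (k - i - j - 2);
    try lia.
  by have le_p := (r2 a c b d ltac:(lia)).2; le_points le_p.
Qed.
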